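(* Let $K$ be a field of characteristic zero, $l\in\mathbb{N}$, and $P,Q\in L^{(l)}=K[x^{\pm1/l},y]$. Set $$\tilde J=\operatorname{Coef}_{x^{-1}y^0}\bigl(Q\,D_x(P)\bigr)\,x^{-1}+\int_y[P,Q],\qquad g=\tilde J-Q\,D_x(P).$$ Then: (1) $D_y(g)=-D_x(Q\,D_y(P))$; (2) $g\in\operatorname{Im}(D_x)$; (3) if $(\rho,\sigma)\in\operatorname{Dir}(P)$ with $\rho\ne0$ and $v_{\rho,\sigma}(\tilde J)=v_{\rho,\sigma}(x^{-1})$, then there is $\lambda\in K^\times$ such that $$y-\lambda x^{\sigma/\rho}\ \text{ divides }\ \ell_{\rho,\sigma}(P)\quad\text{and}\quad \operatorname{ev}_{\lambda x^{\sigma/\rho}}(\ell_{\rho,\sigma}(\tilde J))=0.$$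
   Context: $D_x=\partial/\partial x$ and $D_y=\partial/\partial y$ are the usual derivations on $L^{(l)}$ (with $D_x(x^{1/l})=\frac1l x^{1/l-1}$), $[P,Q]=D_x(P)D_y(Q)-D_x(Q)D_y(P)$, and $\int_y$ is the $K$-linear map with $\int_y x^{i/l}y^j=\frac1{j+1}x^{i/l}y^{j+1}$. $\operatorname{Coef}_{x^{-1}y^0}(P)$ is the coefficient of $x^{-1}y^0$ in $P$. $\operatorname{Im}(D_x)$ is the image of $D_x$; it consists of the elements in which all coefficients of $x^{-1}y^j$, $j\ge0$, vanish. The support of $P$ is the set of exponents $(i/l,j)$ with nonzero coefficient. A direction is $(\rho,\sigma)\in\mathbb{Z}^2$ with $\gcd(\rho,\sigma)=1$. $v_{\rho,\sigma}(P)$ is the supremum of $\rho\frac il+\sigma j$ over the support of $P$; $\ell_{\rho,\sigma}(P)$ is the sum of the terms of $P$ attaining it. $\operatorname{Dir}(P)$ is the set of directions $(\rho,\sigma)$ such that $\ell_{\rho,\sigma}(P)$ has at least two terms. $\operatorname{ev}_\eta(P)$ denotes substitution of $\eta$ for $y$. Divisibility and evaluation involving $x^{\sigma/\rho}$ are taken in $K[x^{\pm1/N},y]$, where $N$ is a common multiple of $l$ and $\rho$.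
   Formalization: In (3), λ is taken in F^× for every algebraically closed extension F of K (F=K if K is algebraically closed), since λ∈K^× can fail: K=ℚ, P=x(y²+1), Q=x⁻¹, direction (1,0). *)

(* Defs.v *)
From HB Require Import structures.
From mathcomp Require Import all_boot all_order all_algebra finmap.
From mathcomp Require Export monalg.

Set Implicit Arguments.
Unset Strict Implicit.
Unset Printing Implicit Defensive.

Import Order.TTheory GRing.Theory Num.Theory.
Local Open Scope fset_scope.
Local Open Scope ring_scope.

(* For every l, K[x^{1/l}, x^{-1/l}] is the subring of the elements whose
   exponents lie in (1/l)Z of one ring K[x^Q], the group algebra of (Q, +):
   finitely supported functions from rat to K with the convolution product.
   As a K-module this is {malg K[rat]}; the product that the library puts on
   malg is not available, since it needs an exponent monoid without nontrivial
   units.  Thus << c *g i >> is c x^i, and f@_i is the coefficient of x^i. *)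
Definition xpoly (K : fieldType) : Type := {malg K[rat]}.

Section XPolyRing.
Context (K : fieldType).

HB.instance Definition _ := GRing.Lmodule.copy (xpoly K) {malg K[rat]}.

Implicit Types (f g : xpoly K) (i j : rat).

Definition xone : xpoly K := << 1 *g 0 >>.

Definition xmul f g : xpoly K :=
  \sum_(i <- msupp f) \sum_(j <- msupp g) << f@_i * g@_j *g i + j >>.

Lemma xmulw (d e : {fset rat}) f g :
  msupp f `<=` d -> msupp g `<=` e ->
  xmul f g = \sum_(i <- d) \sum_(j <- e) << f@_i * g@_j *g i + j >>.
Proof.
move=> le_d le_e; rewrite /xmul (big_fset_incl _ le_d) /=.
  apply/eq_bigr=> i _; apply/big_fset_incl => // j _ /mcoeff_outdom ->.
  by rewrite mulr0 monalgU0.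
move=> i _ /mcoeff_outdom fi.
by rewrite big1 // => j _; rewrite fi mul0r monalgU0.
Qed.

Lemma xmulC : commutative xmul.
Proof.
move=> f g; rewrite /xmul exchange_big /=; apply/eq_bigr=> j _.
by apply/eq_bigr=> i _; rewrite mulrC addrC.
Qed.

Lemma xmul0f : left_zero 0 xmul.
Proof. by move=> f; rewrite /xmul msupp0 big_seq_fset0. Qed.

Lemma xmulUU a b i j : xmul << a *g i >> << b *g j >> = << a * b *g i + j >>.
Proof. by rewrite (xmulw msuppU_le msuppU_le) !big_seq_fset1 !mcoeffUU. Qed.

Lemma xmulDl : left_distributive xmul +%R.
Proof.
move=> f1 f2 g.
rewrite (xmulw (msuppD_le f1 f2) (fsubset_refl (msupp g))).
rewrite [X in _ = X + _](xmulw (fsubsetUl _ (msupp f2)) (fsubset_refl _)).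
rewrite [X in _ = _ + X](xmulw (fsubsetUr (msupp f1) _) (fsubset_refl _)).
rewrite -big_split /=; apply/eq_bigr=> i _.
rewrite -big_split /=; apply/eq_bigr=> j _.
by rewrite mcoeffD mulrDl monalgUD.
Qed.

Lemma xpolyE f : f = \sum_(i <- msupp f) (<< f@_i *g i >> : xpoly K).
Proof. exact: monalgE. Qed.

Lemma xmul1f : left_id xone xmul.
Proof.
move=> f; rewrite (xmulw msuppU_le (fsubset_refl _)) big_seq_fset1.
rewrite [RHS]monalgE; apply/eq_bigr=> i _.
by rewrite mcoeffUU mul1r add0r.
Qed.

Lemma xmul_suml (I : Type) (r : seq I) (F : I -> xpoly K) g :
  xmul (\sum_(i <- r) F i) g = \sum_(i <- r) xmul (F i) g.
Proof. exact: (big_morph (xmul^~ g) (fun _ _ => xmulDl _ _ _) (xmul0f g)). Qed.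

Lemma xmul_sumr (I : Type) (r : seq I) (F : I -> xpoly K) g :
  xmul g (\sum_(i <- r) F i) = \sum_(i <- r) xmul g (F i).
Proof. by rewrite xmulC xmul_suml; apply/eq_bigr=> i _; rewrite xmulC. Qed.

Lemma xmulA : associative xmul.
Proof.
move=> f g h; rewrite (xpolyE f) xmul_suml xmul_suml xmul_suml.
apply/eq_bigr=> i _; rewrite (xpolyE g) xmul_suml !xmul_sumr xmul_suml.
apply/eq_bigr=> j _; rewrite (xpolyE h) !xmul_sumr.
by apply/eq_bigr=> k _; rewrite !xmulUU mulrA addrA.
Qed.

Lemma xone_neq0 : xone != 0.
Proof. by rewrite monalgU_eq0 oner_eq0. Qed.

HB.instance Definition _ := GRing.Zmodule_isComNzRing.Build (xpoly K)
  xmulA xmulC xmul1f xmulDl xone_neq0.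

End XPolyRing.

Section LRing.
Context (K : fieldType).
Local Notation KXY := {poly xpoly K}.

Implicit Types (P Q : KXY) (rho sigma : int).

(* L^(l) = K[x^{1/l}, x^{-1/l}, y], with y the variable 'X. *)
Definition Lring (l : nat) : pred KXY := fun P =>
  all (fun f : xpoly K => all (fun i : rat => l%:R * i \is a Num.int) (msupp f))
      P.

Definition coefxy P (e : rat * nat) : K := (P`_e.2 : xpoly K)@_(e.1).

Definition monoxy (c : K) (e : rat * nat) : KXY :=
  (<< c *g e.1 >> : xpoly K) *: 'X^(e.2).

Definition supp P : seq (rat * nat) :=
  [seq (i, j) | j <- iota 0 (size P), i <- (msupp (P`_j : xpoly K) : seq rat)].

Definition ddx (f : xpoly K) : xpoly K :=
  \sum_(i <- msupp f) << ratr i * f@_i *g i - 1 >>.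

Definition Dx P : KXY := map_poly ddx P.
Definition Dy P : KXY := P^`().

Definition bracket P Q : KXY := Dx P * Dy Q - Dx Q * Dy P.

Definition inty P : KXY :=
  \sum_(e <- supp P) monoxy (e.2.+1%:R^-1 * coefxy P e) (e.1, e.2.+1).

Definition Jtilde P Q : KXY :=
  monoxy (coefxy (Q * Dx P) (-1, 0%N)) (-1, 0%N) + inty (bracket P Q).

Definition weight rho sigma (e : rat * nat) : rat :=
  rho%:~R * e.1 + sigma%:~R * e.2%:R.

(* The maximum in Q with a bottom element None adjoined, to be read -oo. *)
Definition max_bot (a b : option rat) : option rat :=
  match a, b with
  | Some x, Some y => Some (Num.max x y)
  | Some _, None => a
  | None, _ => b
  end.

Definition vdeg rho sigma P : option rat :=
  \big[max_bot/None]_(e <- supp P) Some (weight rho sigma e).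

Definition lead rho sigma P : KXY :=
  \sum_(e <- supp P | Some (weight rho sigma e) == vdeg rho sigma P)
    monoxy (coefxy P e) e.

Definition inDir rho sigma P : bool :=
  coprimez rho sigma && (1 < size (supp (lead rho sigma P)))%N.

(* lambda x^{sigma/rho} *)
Definition eta rho sigma (lambda : K) : xpoly K :=
  << lambda *g sigma%:~R / rho%:~R >>.

Definition dvdL (N : nat) (A B : KXY) : Prop :=
  exists2 R : KXY, R \in Lring N & B = A * R.

End LRing.

(* Extension of scalars K[x^Q][y] -> F[x^Q][y] along iota : K -> F. *)
Definition extL (K F : fieldType) (iota : {rmorphism K -> F})
    (P : {poly xpoly K}) : {poly xpoly F} :=
  map_poly (fun f : xpoly K =>
    \sum_(i <- msupp f) << iota f@_i *g i >> : xpoly F) P.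

(* Main.v *)
From HB Require Import structures.
Require Import Defs.
From mathcomp Require Import all_boot all_order all_algebra finmap.
From mathcomp Require Import ring lra.
Set Implicit Arguments.
Unset Strict Implicit.
Unset Printing Implicit Defensive.

Import Order.TTheory GRing.Theory Num.Theory.
Local Open Scope ring_scope.

(* Since g dx - Q D_y(P) dy is a closed form and g has no residue in x, it is
   dG for some G, that is J dx = dG + Q dP.  For (3), put s = sigma / rho and
   y = x^s z: the (rho, sigma)-degree becomes the degree in x (or its opposite,
   if rho < 0), and the leading forms of P and J become x^w f(z) and
   x^{-1} h(z).  Truncating the geometric series of 1 / P gives, for large M,
   a T with P T = f^M up to very low terms, and taking the coefficient of
   x^{-1} in D_z(G T D_x P) - D_x(G T D_z P) yields
     M f' A - f A' = f^M f' h,   where A = Coef_{x^{-1}}(G T D_x P).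
   Comparing orders of vanishing, h is zero at every root of f, and f has a
   nonzero root as it has at least two terms. *)

(** * Rational numbers in a field of characteristic zero *)

Section RatInField.
Variable K : fieldType.
Hypothesis charK : [pchar K] =i pred0.

Lemma natr_neq0_pchar0 n : (n.+1%:R : K) != 0.
Proof. by move/pcharf0P: charK => ->. Qed.

Lemma intr_eq0_pchar0 (m : int) : (m%:~R == 0 :> K) = (m == 0).
Proof.
case: m => n; first by move/pcharf0P: charK => /(_ n).
by rewrite NegzE mulrNz oppr_eq0 (negPf (natr_neq0_pchar0 n)).
Qed.

Lemma denq_neq0_pchar0 (a : rat) : ((denq a)%:~R : K) != 0.
Proof. by rewrite intr_eq0_pchar0 denq_neq0. Qed.

(** [ratr] uses the reduced fraction, so an arbitrary one is compared with it by
    cross-multiplication; in characteristic zero both denominators stay nonzero in [K]. *)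
Lemma ratr_div_pchar0 (m n : int) : n != 0 ->
  ratr (m%:~R / n%:~R) = m%:~R / n%:~R :> K.
Proof.
move=> n0; set a := m%:~R / n%:~R.
have n0K : (n%:~R : K) != 0 by rewrite intr_eq0_pchar0.
have n0Q : (n%:~R : rat) != 0 by rewrite intr_eq0.
have d0Q : ((denq a)%:~R : rat) != 0 by rewrite intr_eq0 denq_neq0.
have e : numq a * n = m * denq a.
  apply: (@intr_inj rat); rewrite !rmorphM /=.
  rewrite -[(numq a)%:~R](divfK d0Q) divq_num_den /a mulrAC.
  by rewrite divfK.
rewrite /ratr; apply/eqP; rewrite eqr_div ?denq_neq0_pchar0 // -!intrM e.
by rewrite eqxx.
Qed.

Lemma ratrD_pchar0 (a b : rat) : ratr (a + b) = ratr a + ratr b :> K.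
Proof.
rewrite -{1}[a]divq_num_den -{1}[b]divq_num_den.
rewrite addf_div ?intr_eq0 ?denq_neq0 //.
rewrite -!intrM -intrD ratr_div_pchar0 ?mulf_neq0 ?denq_neq0 //.
by rewrite /ratr addf_div ?denq_neq0_pchar0 // intrD !intrM.
Qed.

Lemma ratrMn_pchar0 (a : rat) n : ratr (a *+ n) = ratr a *+ n :> K.
Proof.
elim: n => [|n IH]; last by rewrite !mulrS ratrD_pchar0 IH.
by rewrite !mulr0n /ratr !mul0r.
Qed.

Lemma ratr_eq0_pchar0 (a : rat) : (ratr a == 0 :> K) = (a == 0).
Proof.
rewrite /ratr mulf_eq0 invr_eq0 (negPf (denq_neq0_pchar0 a)) orbF.
by rewrite intr_eq0_pchar0 numq_eq0.
Qed.

End RatInField.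

(** * Coefficients of Laurent polynomials in x with rational exponents *)

Section XPoly.
Variable K : fieldType.
Implicit Types (f g : xpoly K) (i e : rat) (c : K).

Lemma xpolyP f g : (forall e, f@_e = g@_e) -> f = g.
Proof. by move=> h; apply/malgP. Qed.

Lemma xcoefD e f g : (f + g)@_e = f@_e + g@_e.
Proof. exact: mcoeffD. Qed.

Lemma xcoefN e f : (- f)@_e = - f@_e.
Proof. exact: mcoeffN. Qed.

Lemma xcoef0 e : (0 : xpoly K)@_e = 0.
Proof. exact: mcoeff0. Qed.

Lemma xcoef_sum e (I : Type) (r : seq I) (Q : pred I) (F : I -> xpoly K) :
  (\sum_(i <- r | Q i) F i)@_e = \sum_(i <- r | Q i) (F i)@_e.
Proof. exact: (big_morph (mcoeff e) (fun _ _ => xcoefD e _ _) (xcoef0 e)). Qed.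

Definition xmon c i : xpoly K := << c *g i >>.

Lemma xcoef_mon c i e : (xmon c i)@_e = c *+ (i == e).
Proof. exact: mcoeffU. Qed.

Lemma xmonM c d i j : xmon c i * xmon d j = xmon (c * d) (i + j).
Proof. exact: xmulUU. Qed.

Lemma xmon1 : xmon 1 0 = 1.
Proof. by []. Qed.

Lemma xpoly_ind (T : xpoly K -> Prop) :
  T 0 -> (forall f g, T f -> T g -> T (f + g)) -> (forall c i, T (xmon c i)) ->
  forall f, T f.
Proof.
move=> T0 TD TU f; rewrite [f]xpolyE.
by elim/big_ind: _ => // i _; apply: TU.
Qed.

(** The condition on [F 0 e] covers an [e] outside the support, where the sum is empty of matching
    terms. *)
Lemma sum_msupp (V : nmodType) f (F : K -> rat -> V) e : F 0 e = 0 ->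
  \sum_(i <- msupp f) F f@_i i *+ (i == e) = F f@_e e.
Proof.
move=> F0; case: (boolP (e \in msupp f)) => he.
  rewrite (bigD1_seq e) ?fset_uniq //= eqxx big1 ?addr0 // => i /negPf ->.
  by rewrite mulr0n.
rewrite (mcoeff_outdom he) F0 big1_seq // => i /andP[_ hi].
by case: eqP => // ei; rewrite -ei hi in he.
Qed.

Lemma xcoef_monM c i f e : (xmon c i * f)@_e = c * f@_(e - i).
Proof.
elim/xpoly_ind: f => [|f g hf hg|d j].
- by rewrite mulr0 !xcoef0 mulr0.
- by rewrite mulrDr !xcoefD hf hg mulrDr.
rewrite xmonM !xcoef_mon mulrnAr; congr (_ *+ _).
by rewrite [i + j]addrC -subr_eq0 -[in RHS]subr_eq0 opprB addrA.
Qed.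

Lemma xcoefC_M c f e : (xmon c 0 * f)@_e = c * f@_e.
Proof. by rewrite xcoef_monM subr0. Qed.

End XPoly.

(** * The derivation in x *)

Section XDerivation.
Variable K : fieldType.
Hypothesis charK : [pchar K] =i pred0.
Implicit Types (f g : xpoly K) (i e : rat) (c : K).

Lemma xcoef_ddx f e : (ddx f)@_e = ratr (e + 1) * f@_(e + 1).
Proof.
rewrite /ddx xcoef_sum -(@sum_msupp _ _ f (fun c i => ratr i * c)) ?mulr0 //.
by apply: eq_bigr => i _; rewrite mcoeffU subr_eq.
Qed.

Fact ddx_is_zmod_morphism : zmod_morphism (@ddx K).
Proof.
move=> f g; apply: xpolyP => e.
by rewrite xcoefD xcoefN !xcoef_ddx xcoefD xcoefN mulrBr.
Qed.

HB.instance Definition _ :=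
  GRing.isZmodMorphism.Build (xpoly K) (xpoly K) (@ddx K) ddx_is_zmod_morphism.

Lemma ddx_mon c i : ddx (xmon c i) = xmon (ratr i * c) (i - 1).
Proof.
apply: xpolyP => e; rewrite xcoef_ddx !xcoef_mon subr_eq mulrnAr.
by case: eqP => // ->.
Qed.

(** By linearity [f] may be a monomial of exponent [i]; coefficientwise the rule is then the
    additivity of [ratr] on e + 1 = i + (e + 1 - i). *)
Lemma ddxM f g : ddx (f * g) = ddx f * g + f * ddx g.
Proof.
elim/xpoly_ind: f => [|f1 f2 h1 h2|c i].
- by rewrite raddf0 !mul0r raddf0 addr0.
- by rewrite mulrDl !raddfD /= h1 h2 !mulrDl addrACA.
apply: xpolyP => e.
rewrite xcoefD xcoef_ddx ddx_mon !xcoef_monM xcoef_ddx.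
have -> : e - (i - 1) = e + 1 - i by ring.
have -> : e - i + 1 = e + 1 - i by ring.
have -> : ratr (e + 1) = ratr i + ratr (e + 1 - i) :> K.
  by rewrite -(ratrD_pchar0 charK); congr ratr; ring.
ring.
Qed.

End XDerivation.

(** * Coefficientwise calculus in x and y; the form g dx - Q D_y(P) dy *)

Section Coefxy.
Variable K : fieldType.
Implicit Types (P Q : {poly xpoly K}) (e : rat * nat) (i : rat) (j : nat).

Lemma coefxyP P Q : (forall i j, coefxy P (i, j) = coefxy Q (i, j)) -> P = Q.
Proof. by move=> h; apply/polyP => j; apply: xpolyP => i; exact: (h i j). Qed.

Lemma coefxyD P Q e : coefxy (P + Q) e = coefxy P e + coefxy Q e.
Proof. by rewrite /coefxy coefD xcoefD. Qed.

Lemma coefxyN P e : coefxy (- P) e = - coefxy P e.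
Proof. by rewrite /coefxy coefN xcoefN. Qed.

Lemma coefxyB P Q e : coefxy (P - Q) e = coefxy P e - coefxy Q e.
Proof. by rewrite coefxyD coefxyN. Qed.

Lemma coefxy0 e : coefxy (0 : {poly xpoly K}) e = 0.
Proof. by rewrite /coefxy coef0 xcoef0. Qed.

Lemma coefxy_sum e (I : Type) (r : seq I) (T : pred I)
    (F : I -> {poly xpoly K}) :
  coefxy (\sum_(i <- r | T i) F i) e = \sum_(i <- r | T i) coefxy (F i) e.
Proof.
elim/big_rec2: _ => [|i x y _ <-]; first exact: coefxy0.
exact: coefxyD.
Qed.

Lemma coefxy_monoxy (c : K) e e' : coefxy (monoxy c e) e' = c *+ (e == e').
Proof.
case: e e' => [i j] [i' j']; rewrite /coefxy /monoxy coefZ coefXn /=.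
rewrite xpair_eqE [j' == j]eq_sym; case: (j == j') => /=.
  by rewrite mulr1 andbT -/(xmon c i) xcoef_mon.
by rewrite mulr0 andbF xcoef0.
Qed.

Lemma mem_supp P e : (e \in supp P) = (coefxy P e != 0).
Proof.
case: e => i j; rewrite /coefxy /=; apply/allpairsPdep/idP => /=.
  by case=> j' [i' [_ hi [-> ->]]]; rewrite mcoeff_neq0.
move=> nz; exists j, i; split=> //; last by rewrite -mcoeff_neq0.
rewrite mem_iota add0n ltnNge; apply/negP => hj.
by rewrite nth_default // xcoef0 eqxx in nz.
Qed.

Lemma supp_uniq P : uniq (supp P).
Proof.
apply: allpairs_uniq_dep; first exact: iota_uniq.
  by move=> j _; exact: fset_uniq.
by move=> [j i] [j' i'] _ _ /= [-> ->].
Qed.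

Lemma sum_supp P (F : rat * nat -> K) e :
  (coefxy P e = 0 -> F e = 0) ->
  \sum_(e' <- supp P) F e' *+ (e' == e) = F e.
Proof.
move=> F0; case: (boolP (e \in supp P)) => he.
  rewrite (bigD1_seq e) ?supp_uniq //= eqxx big1 ?addr0 // => e' /negPf ->.
  by rewrite mulr0n.
rewrite F0; last by move: he; rewrite mem_supp negbK => /eqP.
rewrite big1_seq // => e' /andP[_ he'].
by case: eqP => // ee; rewrite -ee he' in he.
Qed.

Lemma coef_Dx P j : (Dx P)`_j = ddx P`_j.
Proof. by rewrite coef_map_id0 // /ddx msupp0 big_seq_fset0. Qed.

Lemma coefxy_Dy P i j : coefxy (Dy P) (i, j) = coefxy P (i, j.+1) *+ j.+1.
Proof. by rewrite /coefxy /Dy coef_deriv /=; exact: mcoeffMn. Qed.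

Lemma coefxy_inty0 P i : coefxy (inty P) (i, 0) = 0.
Proof.
rewrite /inty coefxy_sum big1 // => -[i' j'] _.
by rewrite coefxy_monoxy xpair_eqE andbF.
Qed.

Lemma coefxy_intyS P i j :
  coefxy (inty P) (i, j.+1) = j.+1%:R^-1 * coefxy P (i, j).
Proof.
rewrite /inty coefxy_sum.
rewrite -[RHS](@sum_supp P (fun e => e.2.+1%:R^-1 * coefxy P e) (i, j)) => [|/= ->].
  by apply: eq_bigr => -[i' j'] _; rewrite coefxy_monoxy !xpair_eqE eqSS.
by rewrite mulr0.
Qed.

Fact Dy_is_zmod_morphism : zmod_morphism (@Dy K).
Proof. by move=> P Q; exact: derivB. Qed.

HB.instance Definition _ := GRing.isZmodMorphism.Build
  {poly xpoly K} {poly xpoly K} (@Dy K) Dy_is_zmod_morphism.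

Lemma DyM P Q : Dy (P * Q) = Dy P * Q + P * Dy Q.
Proof. exact: derivM. Qed.

Section CharZero.
Hypothesis charK : [pchar K] =i pred0.

Lemma coefxy_Dx P i j :
  coefxy (Dx P) (i, j) = ratr (i + 1) * coefxy P (i + 1, j).
Proof. by rewrite /coefxy coef_Dx xcoef_ddx. Qed.

Fact Dx_is_zmod_morphism : zmod_morphism (@Dx K).
Proof.
by move=> P Q; apply/polyP => j; rewrite coefB !coef_Dx coefB raddfB.
Qed.

HB.instance Definition _ := GRing.isZmodMorphism.Build
  {poly xpoly K} {poly xpoly K} (@Dx K) Dx_is_zmod_morphism.

Lemma DxM P Q : Dx (P * Q) = Dx P * Q + P * Dx Q.
Proof.
apply/polyP => j; rewrite coef_Dx coefD !coefM raddf_sum -big_split /=.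
by apply: eq_bigr => k _; rewrite (ddxM charK) !coef_Dx.
Qed.

Lemma DxDy P : Dx (Dy P) = Dy (Dx P).
Proof.
apply: coefxyP => i j; rewrite coefxy_Dx !coefxy_Dy coefxy_Dx.
by rewrite mulrnAr.
Qed.

Lemma Dy_inty P : Dy (inty P) = P.
Proof.
apply: coefxyP => i j; rewrite coefxy_Dy coefxy_intyS -[LHS]mulr_natl mulVKf //.
exact: natr_neq0_pchar0.
Qed.

Lemma Dx_inty P : Dx (inty P) = inty (Dx P).
Proof.
apply: coefxyP => i [|j]; rewrite coefxy_Dx ?coefxy_inty0 ?mulr0 //.
by rewrite !coefxy_intyS coefxy_Dx mulrCA.
Qed.

Lemma Dy_monoxy0 (c : K) i : Dy (monoxy c (i, 0)) = 0.
Proof. by rewrite /Dy /monoxy /= expr0 derivZ derivC scaler0. Qed.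

Lemma Dy_Jtilde P Q : Dy (Jtilde P Q) = bracket P Q.
Proof. by rewrite /Jtilde raddfD /= Dy_monoxy0 Dy_inty add0r. Qed.

(** By the Leibniz rule the terms D_y(Q) D_x(P) cancel, and the second derivatives of [P] agree
    because the derivations commute. *)
Lemma Dy_form P Q : Dy (Jtilde P Q - Q * Dx P) = - Dx (Q * Dy P).
Proof.
rewrite raddfB /= Dy_Jtilde DyM DxM -DxDy /bracket; ring.
Qed.

(** For j = 0 the monomial added in [Jtilde] cancels the residue. For higher powers of y, D_y(g) is
    an x-derivative and so has no x^{-1} term; characteristic zero allows division by j + 1. *)
Lemma coefxy_form_N1 P Q j : coefxy (Jtilde P Q - Q * Dx P) (-1, j) = 0.
Proof.
case: j => [|j].
  rewrite coefxyB /Jtilde coefxyD coefxy_monoxy eqxx coefxy_inty0.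
  by rewrite addr0 subrr.
have := congr1 (fun A => coefxy A (-1, j)) (Dy_form P Q).
rewrite coefxy_Dy coefxyN coefxy_Dx addNr /ratr mul0r mul0r oppr0.
rewrite -mulr_natl => /eqP; rewrite mulf_eq0.
by rewrite (negPf (natr_neq0_pchar0 charK j)) => /eqP.
Qed.

(** At exponent -1 the factor is the inverse of 0, which is 0, so x^{-1} terms are dropped. *)
Definition intx P : {poly xpoly K} :=
  \sum_(e <- supp P) monoxy ((ratr (e.1 + 1))^-1 * coefxy P e) (e.1 + 1, e.2).

Lemma coefxy_intx P i j :
  coefxy (intx P) (i, j) = (ratr i)^-1 * coefxy P (i - 1, j).
Proof.
rewrite /intx coefxy_sum.
rewrite -{2}[i](subrK 1).
rewrite -[RHS](@sum_supp P (fun e => (ratr (e.1 + 1))^-1 * coefxy P e)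
  (i - 1, j)) => [|/= ->].
  apply: eq_bigr => -[i' j'] _; rewrite coefxy_monoxy !xpair_eqE /=.
  by rewrite [_ == i - 1]eq_sym subr_eq eq_sym.
by rewrite mulr0.
Qed.

Lemma Dx_intx P : (forall j, coefxy P (-1, j) = 0) -> Dx (intx P) = P.
Proof.
move=> P0; apply: coefxyP => i j; rewrite coefxy_Dx coefxy_intx addrK.
have [->|ni] := eqVneq i (-1); first by rewrite P0 !mulr0.
rewrite mulVKf // (ratr_eq0_pchar0 charK).
by rewrite addr_eq0.
Qed.

End CharZero.

End Coefxy.

(** * Closure of L^(l) under the operations used *)

Section LringClosure.
Variables (K : fieldType) (l : nat).
Implicit Types (P Q : {poly xpoly K}) (f g : xpoly K) (i : rat) (j : nat).

Lemma LringP P :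
  reflect (forall i j, coefxy P (i, j) != 0 -> l%:R * i \is a Num.int)
          (P \in Lring l).
Proof.
apply: (iffP allP) => [h i j nz | h f /(nthP 0) [j hj <-]].
  have hj : (j < size P)%N.
    rewrite ltnNge; apply/negP => hj; move: nz.
    by rewrite /coefxy nth_default //= xcoef0 eqxx.
  have /allP := h _ (mem_nth 0 hj); apply.
  by rewrite -mcoeff_neq0.
by apply/allP => i hi; apply: (h i j); rewrite /coefxy mcoeff_neq0.
Qed.

Lemma xmul_support f g e : (f * g)@_e != 0 ->
  exists i, f@_i != 0 /\ g@_(e - i) != 0.
Proof.
rewrite [f * g]/(xmul f g) /xmul xcoef_sum => nz.
have [i hi hi2] : exists2 i, i \in msupp f & g@_(e - i) != 0.
  apply/hasP; move: nz; apply: contraNT => /hasPn h.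
  apply/eqP; apply: big1_seq => i /andP[_ hi].
  rewrite xcoef_sum; apply: big1_seq => j /andP[_ hj].
  rewrite mcoeffU; case: eqP => // ije; have := h i hi.
  by rewrite -ije addrC addKr mcoeff_neq0 hj.
by exists i; rewrite mcoeff_neq0.
Qed.

Lemma coefxyM_support P Q i j : coefxy (P * Q) (i, j) != 0 ->
  exists i1 j1 i2 j2, [/\ coefxy P (i1, j1) != 0, coefxy Q (i2, j2) != 0,
    i = i1 + i2 & j = (j1 + j2)%N].
Proof.
rewrite /coefxy coefM xcoef_sum /= => nz.
have /existsP[k hk] : [exists k : 'I_j.+1, (P`_k * Q`_(j - k))@_i != 0].
  move: nz; apply: contraNT => /existsPn h.
  by apply/eqP; apply: big1 => k _; apply/eqP; rewrite -[_ == _]negbK.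
have [e [h1 h2]] := xmul_support hk.
exists e, k, (i - e), (j - k)%N; split => //; first by ring.
by rewrite subnKC // -ltnS.
Qed.

Lemma LringD P Q : P \in Lring l -> Q \in Lring l -> P + Q \in Lring l.
Proof.
move=> /LringP hP /LringP hQ; apply/LringP => i j; rewrite coefxyD => nz.
have [z|z] := eqVneq (coefxy P (i, j)) 0; last exact: hP z.
by apply: (hQ i j); rewrite z add0r in nz.
Qed.

Lemma LringN P : P \in Lring l -> - P \in Lring l.
Proof.
by move=> /LringP hP; apply/LringP => i j; rewrite coefxyN oppr_eq0 => /hP.
Qed.

Lemma LringM P Q : P \in Lring l -> Q \in Lring l -> P * Q \in Lring l.
Proof.
move=> /LringP hP /LringP hQ; apply/LringP => i j.
move=> /coefxyM_support[i1 [j1 [i2 [j2 [h1 h2 -> _]]]]].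
by rewrite mulrDr rpredD ?(hP _ _ h1) ?(hQ _ _ h2).
Qed.

Lemma natr_shift_int i : l%:R * (i + 1) \is a Num.int ->
  l%:R * i \is a Num.int.
Proof. by rewrite mulrDr mulr1 rpredDr // rpred_nat. Qed.

Lemma Lring_Dx P : P \in Lring l -> Dx P \in Lring l.
Proof.
move=> /LringP hP; apply/LringP => i j; rewrite coefxy_Dx.
by rewrite mulf_eq0 negb_or => /andP[_ /hP/natr_shift_int].
Qed.

Lemma Lring_Dy P : P \in Lring l -> Dy P \in Lring l.
Proof.
move=> /LringP hP; apply/LringP => i j; rewrite coefxy_Dy => nz.
by apply: (hP i j.+1); apply: contraNN nz => /eqP->; rewrite mul0rn.
Qed.

Lemma Lring_inty P : P \in Lring l -> inty P \in Lring l.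
Proof.
move=> /LringP hP; apply/LringP => i [|j]; first by rewrite coefxy_inty0 eqxx.
by rewrite coefxy_intyS mulf_eq0 negb_or => /andP[_ /hP].
Qed.

Lemma Lring_intx P : P \in Lring l -> intx P \in Lring l.
Proof.
move=> /LringP hP; apply/LringP => i j; rewrite coefxy_intx.
rewrite mulf_eq0 negb_or => /andP[_ /hP].
have -> : l%:R * i = l%:R * (i - 1) + l%:R by ring.
by move=> h; rewrite rpredD // rpred_nat.
Qed.

Lemma Lring_monoxy (c : K) i j : l%:R * i \is a Num.int ->
  monoxy c (i, j) \in Lring l.
Proof.
move=> hi; apply/LringP => i' j'; rewrite coefxy_monoxy xpair_eqE.
by case: (i =P i') => [<- //|_]; rewrite eqxx.
Qed.

Lemma Lring_Jtilde P Q : P \in Lring l -> Q \in Lring l ->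
  Jtilde P Q \in Lring l.
Proof.
move=> hP hQ; apply: LringD.
  by apply: Lring_monoxy; rewrite mulrN1 rpredN rpred_nat.
by apply/Lring_inty/LringD; [|apply/LringN]; apply: LringM;
  rewrite ?Lring_Dx ?Lring_Dy.
Qed.

Lemma Lring_form P Q : P \in Lring l -> Q \in Lring l ->
  Jtilde P Q - Q * Dx P \in Lring l.
Proof.
move=> hP hQ; apply: LringD; first exact: Lring_Jtilde.
by apply/LringN/LringM; rewrite ?Lring_Dx.
Qed.

End LringClosure.

(** * A potential of the closed form *)

Section Potential.
Variable K : fieldType.
Hypothesis charK : [pchar K] =i pred0.
Implicit Types P Q : {poly xpoly K}.

(* The correction by inty absorbs the x-free defect in y of the naive
   primitive of g in x. *)
Lemma exists_potential P Q : exists G : {poly xpoly K},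
  Dx G = Jtilde P Q - Q * Dx P /\ Dy G = - (Q * Dy P).
Proof.
set g := Jtilde P Q - Q * Dx P.
have Dxh : Dx (intx g) = g.
  by apply: (Dx_intx charK) => j; exact: coefxy_form_N1.
set C := Dy (intx g) + Q * Dy P.
have DxC : Dx C = 0.
  by rewrite /C raddfD /= DxDy Dxh (Dy_form charK) addNr.
exists (intx g - inty C); split.
  rewrite raddfB /= Dxh Dx_inty DxC.
  suff -> : inty (0 : {poly xpoly K}) = 0 by rewrite subr0.
  apply: coefxyP => i [|j]; rewrite ?coefxy_inty0 ?coefxy_intyS !coefxy0 //.
  by rewrite mulr0.
by rewrite raddfB /= (Dy_inty charK) /C; ring.
Qed.

End Potential.

(** After the shear a leading form is x^w times such a coefficient, which reduces it to a polynomial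
    in one variable over [K]. *)
HB.lock Definition xc (K : fieldType) (e : rat) (A : {poly xpoly K}) : {poly K} :=
  \poly_(j < size A) coefxy A (e, j).

Arguments xc {K}.

(** * Coefficients of powers of x, as polynomials in y *)

Section XCoefficient.
Variable K : fieldType.
Implicit Types (P Q A B : {poly xpoly K}) (p q : {poly K}) (i e : rat).

Lemma coef_xc e A j : (xc e A)`_j = coefxy A (e, j).
Proof.
rewrite xc.unlock coef_poly; case: ltnP => // hj.
by rewrite /coefxy nth_default // xcoef0.
Qed.

Lemma xcP A B : (forall e, xc e A = xc e B) -> A = B.
Proof. by move=> h; apply: coefxyP => i j; rewrite -!coef_xc h. Qed.

Fact xc_is_zmod_morphism e : zmod_morphism (@xc K e).
Proof.
by move=> A B; apply/polyP => j; rewrite coefB !coef_xc coefxyB.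
Qed.

HB.instance Definition _ e := GRing.isZmodMorphism.Build
  {poly xpoly K} {poly K} (@xc K e) (xc_is_zmod_morphism e).

Definition xcst (c : K) : xpoly K := xmon c 0.

Fact xcst_is_zmod_morphism : zmod_morphism xcst.
Proof. by move=> c d; exact: monalgUB. Qed.

Fact xcst_is_monoid_morphism : monoid_morphism xcst.
Proof. by split=> // c d; rewrite /xcst xmonM addr0. Qed.

HB.instance Definition _ := GRing.isZmodMorphism.Build
  K (xpoly K) xcst xcst_is_zmod_morphism.
HB.instance Definition _ := GRing.isMonoidMorphism.Build
  K (xpoly K) xcst xcst_is_monoid_morphism.

Definition cst p : {poly xpoly K} := map_poly xcst p.

HB.instance Definition _ := GRing.RMorphism.copy cst (map_poly xcst).

Definition xpow e : {poly xpoly K} := (xmon 1 e)%:P.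

Lemma xc_cstM e p A : xc e (cst p * A) = p * xc e A.
Proof.
apply/polyP => j; rewrite coef_xc /coefxy !coefM xcoef_sum /=.
by apply: eq_bigr => k _; rewrite coef_map /= xcoefC_M coef_xc.
Qed.

Lemma xc_xpowM e i A : xc e (xpow i * A) = xc (e - i) A.
Proof.
apply/polyP => j; rewrite !coef_xc /coefxy coefCM /=.
by rewrite xcoef_monM mul1r.
Qed.

Lemma xc1 e : xc e (1 : {poly xpoly K}) = (e == 0)%:R.
Proof.
apply/polyP => j; rewrite coef_xc /coefxy /= coef1 -polyC_natr coefC.
case: (j == 0)%N; last exact: xcoef0.
by rewrite mulr1n -xmon1 xcoef_mon eq_sym; case: (e == 0).
Qed.

Lemma xc_cst e p : xc e (cst p) = p *+ (e == 0).
Proof. by rewrite -[cst p]mulr1 xc_cstM xc1 mulr_natr. Qed.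

Lemma xc_xpow e i : xc e (xpow i) = (e == i)%:R.
Proof. by rewrite -[xpow i]mulr1 xc_xpowM xc1 subr_eq0. Qed.

Lemma xc_Dy e A : xc e (Dy A) = (xc e A)^`().
Proof.
by apply/polyP => j; rewrite coef_xc coefxy_Dy coef_deriv coef_xc.
Qed.

Lemma xc_Dx e A : xc e (Dx A) = ratr (e + 1) *: xc (e + 1) A.
Proof.
by apply/polyP => j; rewrite coef_xc coefxy_Dx coefZ coef_xc.
Qed.

Lemma Dy_cst p : Dy (cst p) = cst p^`().
Proof. exact: deriv_map. Qed.

Lemma Dx_cst p : Dx (cst p) = 0.
Proof.
apply: xcP => e; rewrite xc_Dx raddf0 xc_cst.
by case: eqP => [->|_]; rewrite ?mulr0n ?scaler0 // /ratr !mul0r scale0r.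
Qed.

Definition xsupp A : seq rat := undup (map fst (supp A)).

Lemma xsuppPn e A : e \notin xsupp A -> xc e A = 0.
Proof.
rewrite mem_undup => he; apply/polyP => j; rewrite coef_xc coef0.
apply/eqP; move: he; apply: contraNT => nz.
by apply/mapP; exists (e, j); rewrite ?mem_supp.
Qed.

Lemma sum_xsupp A (F : rat -> {poly K}) e : (xc e A = 0 -> F e = 0) ->
  \sum_(i <- xsupp A) F i *+ (e == i) = F e.
Proof.
move=> F0; case: (boolP (e \in xsupp A)) => he.
  rewrite (bigD1_seq e) ?undup_uniq //= eqxx big1 ?addr0 // => i.
  by rewrite eq_sym => /negPf ->; rewrite mulr0n.
rewrite F0 ?xsuppPn // big1_seq // => i /andP[_ hi].
by case: eqP => // ei; rewrite ei hi in he.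
Qed.

Lemma xdecomp A : A = \sum_(i <- xsupp A) cst (xc i A) * xpow i.
Proof.
apply: xcP => e; rewrite raddf_sum /= -[LHS](@sum_xsupp A (fun i => xc i A)) //.
by apply: eq_bigr => i _; rewrite xc_cstM xc_xpow mulr_natr.
Qed.

Lemma xcM e A B : xc e (A * B) = \sum_(i <- xsupp A) xc i A * xc (e - i) B.
Proof.
rewrite {1}[A]xdecomp mulr_suml raddf_sum /=.
by apply: eq_bigr => i _; rewrite -mulrA xc_cstM xc_xpowM.
Qed.

End XCoefficient.

(** * One-sided bounds on the degree in x *)

Section XBound.
Variables (K : fieldType) (r : rat).
Implicit Types (A B : {poly xpoly K}) (p : {poly K}) (d e : rat).

(* The sign of r decides which end of the x-degrees is bounded. *)
Definition xbnd d A : Prop := forall e, d < r * e -> xc e A = 0.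

Lemma xbnd_weaken d d' A : d <= d' -> xbnd d A -> xbnd d' A.
Proof. by move=> dd h e /(le_lt_trans dd)/h. Qed.

Lemma xbndD d A B : xbnd d A -> xbnd d B -> xbnd d (A + B).
Proof. by move=> hA hB e he; rewrite raddfD /= hA ?hB ?addr0. Qed.

Lemma xbndN d A : xbnd d A -> xbnd d (- A).
Proof. by move=> hA e he; rewrite raddfN /= hA ?oppr0. Qed.

Lemma xbndB d A B : xbnd d A -> xbnd d B -> xbnd d (A - B).
Proof. by move=> hA hB; apply: xbndD => //; apply: xbndN. Qed.

Lemma xbnd_sum d (I : Type) (s : seq I) (T : pred I)
    (F : I -> {poly xpoly K}) :
  (forall i, T i -> xbnd d (F i)) -> xbnd d (\sum_(i <- s | T i) F i).
Proof.
move=> h e he; rewrite raddf_sum big1 // => i Ti; exact: h.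
Qed.

Lemma xbnd_cst p : xbnd 0 (cst p).
Proof.
move=> e he; rewrite xc_cst; case: eqP he => [->|//].
by rewrite mulr0 ltxx.
Qed.

Lemma xbnd_xpow e : xbnd (r * e) (xpow K e).
Proof. by move=> e' he; rewrite xc_xpow; case: eqP he => [->|//]; rewrite ltxx. Qed.

Lemma xbndM d d' A B : xbnd d A -> xbnd d' B -> xbnd (d + d') (A * B).
Proof.
move=> hA hB e he; rewrite xcM big1 // => i _.
case: (ltP d (r * i)) => [/hA ->|hi]; first by rewrite mul0r.
rewrite hB ?mulr0 // mulrBr; lra.
Qed.

Lemma xbndX d A n : xbnd d A -> xbnd (d *+ n) (A ^+ n).
Proof.
move=> hA; elim: n => [|n IH]; last by rewrite exprS mulrS; apply: xbndM.
by rewrite expr0 mulr0n -(rmorph1 (@cst K)); apply: xbnd_cst.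
Qed.

Lemma xbnd_cstM d p A : xbnd d A -> xbnd d (cst p * A).
Proof. by move=> hA e he; rewrite xc_cstM hA ?mulr0. Qed.

Lemma xbnd_Dy d A : xbnd d A -> xbnd d (Dy A).
Proof. by move=> hA e he; rewrite xc_Dy hA ?deriv0. Qed.

Lemma xbnd_Dx d A : xbnd d A -> xbnd (d - r) (Dx A).
Proof. by move=> hA e he; rewrite xc_Dx hA ?scaler0 // mulrDr mulr1; lra. Qed.

(** In the convolution, every index other than [a] puts one of the two factors beyond its bound. *)
Lemma xcM_top a b A B : r != 0 -> xbnd (r * a) A -> xbnd (r * b) B ->
  xc (a + b) (A * B) = xc a A * xc b B.
Proof.
move=> r0 hA hB; rewrite xcM.
rewrite -[RHS](@sum_xsupp _ A (fun i => xc i A * xc b B) a) => [|->]; last first.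
  by rewrite mul0r.
apply: eq_bigr => i _; case: eqP => [<-|/eqP ai].
  by rewrite addrAC subrr add0r.
rewrite mulr0n.
have [h|h|h] := ltgtP (r * i) (r * a).
- by rewrite hB ?mulr0 // mulrBr mulrDr; lra.
- by rewrite hA ?mul0r.
- by case/eqP: ai; apply: (mulfI r0).
Qed.

Lemma xbnd_exists A : exists d, xbnd d A.
Proof.
suff [d hd] : exists d, forall e, e \in xsupp A -> r * e <= d.
  exists d => e he; apply: xsuppPn; apply/negP => /hd.
  by rewrite leNgt he.
elim: (xsupp A) => [|a s [d hd]]; first by exists 0.
exists (Num.max d (r * a)) => e; rewrite inE le_max => /predU1P[->|/hd ->] //.
by rewrite lexx orbT.
Qed.

(** Only finitely many exponents occur, so negative degrees are uniformly negative. *)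
Lemma xbnd_gap A : (forall e, 0 <= r * e -> xc e A = 0) ->
  exists2 d, 0 < d & xbnd (- d) A.
Proof.
move=> hA.
suff [d d0 hd] : exists2 d, 0 < d & forall e, e \in xsupp A ->
    xc e A != 0 -> r * e <= - d.
  exists d => // e he; apply/eqP; apply/negPn/negP => nz.
  have [hs|hs] := boolP (e \in xsupp A); last by rewrite xsuppPn ?eqxx in nz.
  by have := hd e hs nz; rewrite leNgt he.
elim: (xsupp A) => [|a s [d d0 hd]]; first by exists 1.
have [z|nz] := eqVneq (xc a A) 0.
  exists d => // e; rewrite inE => /predU1P[->|/hd//]; by rewrite z eqxx.
have ra : r * a < 0 by rewrite ltNge; apply: contraNN nz => /hA ->.
exists (Num.min d (- (r * a))); first by rewrite lt_min d0 oppr_gt0.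
move=> e; rewrite inE lerNr ge_min => /predU1P[-> _|hs nze].
  by rewrite lexx orbT.
by rewrite lerNr hd.
Qed.

End XBound.

(* The substitution y := x^s y; locked, since unification is apt to unfold
   it down to rational arithmetic on exponents. *)
HB.lock Definition shear (K : fieldType) (s : rat) (A : {poly xpoly K}) :
    {poly xpoly K} :=
  A \Po (xpow K s * 'X).

Arguments shear {K}.

(** * Coefficients and chain rules for the shear *)

Section Shear.
Variable K : fieldType.
Hypothesis charK : [pchar K] =i pred0.
Implicit Types (A B : {poly xpoly K}) (s i e : rat) (j : nat).

Lemma xmonX s j : xmon (1 : K) s ^+ j = xmon 1 (s * j%:R).
Proof.
elim: j => [|j IH]; first by rewrite mulr0.
by rewrite exprS IH xmonM mulr1 -[j.+1]addn1 natrD mulrDr mulr1 addrC.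
Qed.

Lemma coefxy_shear s A i j :
  coefxy (shear s A) (i, j) = coefxy A (i - s * j%:R, j).
Proof.
rewrite /coefxy shear.unlock coef_comp_poly /=.
have E k : ((xpow K s * 'X) ^+ k)`_j = xmon 1 (s * j%:R) *+ (k == j).
  rewrite exprMn -rmorphXn /= coefCM coefXn xmonX eq_sym mulr_natr.
  by case: eqP => [->|//].
under eq_bigr do rewrite E.
have [hj|hj] := ltnP j (size A); last first.
  rewrite [A`_j]nth_default // xcoef0 big1 ?xcoef0 // => k _.
  by rewrite (_ : (k == j :> nat) = false) ?mulr0 ?mulr0n ?mulr0 //;
     apply/eqP => kj; move: (ltn_ord k); rewrite kj ltnNge hj.
rewrite (bigD1 (Ordinal hj)) //= eqxx mulr1n big1 ?addr0.
  by rewrite mulrC xcoef_monM mul1r.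
move=> k kj; rewrite (_ : (k == j :> nat) = false) ?mulr0n ?mulr0 //.
by apply: contraNF kj => /eqP kj; apply/eqP/val_inj.
Qed.

Lemma Dy_shear s A : Dy (shear s A) = xpow K s * shear s (Dy A).
Proof.
rewrite /Dy shear.unlock deriv_comp mulrC; congr (_ * _).
by rewrite derivM derivC derivX mul0r add0r mulr1.
Qed.

(** Chain rule for A(x, x^s y). The inner derivative s x^{s-1} y multiplies the sheared D_y(A); by
    [Dy_shear] its factor x^s is absorbed into [Dy (shear s A)]. *)
Lemma Dx_shear s A : Dx (shear s A) =
  shear s (Dx A) + cst (ratr s *: 'X) * (xpow K (-1) * Dy (shear s A)).
Proof.
apply: xcP => e; rewrite raddfD /= xc_cstM xc_xpowM xc_Dy xc_Dx opprK.
apply/polyP => j; rewrite coefD -scalerAl.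
(* Rewriting must not try to unify e + 1 with e, which unfolds rat. *)
have [u Eu] : exists u, u = e + 1 by exists (e + 1).
rewrite -Eu (coefZ (ratr u)) (coefZ (ratr s)) coefXM coef_deriv.
rewrite (coef_xc u) (coef_xc e) (coef_xc u) !coefxy_shear coefxy_Dx.
have -> : e - s * j%:R + 1 = u - s * j%:R by rewrite Eu; ring.
case: j => [|j] /=; first by rewrite mulr0 !subr0 mulr0 addr0.
rewrite (mulrnAr (ratr s)) -mulrnAl -mulrDl; congr (_ * _); rewrite addrC.
(* The exponent of x splits into the share of y^{j+1} under the shear and the exponent in [A], one
   for each term of the chain rule. *)
have {1}-> : u = s *+ j.+1 + (u - s * j.+1%:R) by rewrite -mulr_natr; ring.
by rewrite (ratrD_pchar0 charK (s *+ j.+1)) (ratrMn_pchar0 charK).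
Qed.

End Shear.

(** * The differential equation satisfied by the leading coefficients *)

Section LeadingResidue.
Variable K : fieldType.
Hypothesis charK : [pchar K] =i pred0.
Variables (r w : rat) (P G J : {poly xpoly K}).
Hypothesis r_neq0 : r != 0.
Hypothesis P_bnd : xbnd r (r * w) P.
Hypothesis P_top : xc w P != 0.
Hypothesis J_bnd : xbnd r (- r) J.
(** This is the wedge product of J dx = dG + Q dP with dP, which eliminates Q. *)
Hypothesis JE : J * Dy P = Dx G * Dy P - Dy G * Dx P.
Local Notation f := (xc w P).

Let U := cst f - xpow K (- w) * P.

(** The x^0 term of x^{-w} P is [f] and cancels in [U]; all other terms of x^{-w} P have negative
    degree. *)
Let U_gap : exists2 d, 0 < d & xbnd r (- d) U.
Proof.
apply: xbnd_gap => e he; rewrite /U raddfB /= xc_cst xc_xpowM opprK.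
have [->|ne] := eqVneq e 0; first by rewrite add0r mulr1n subrr.
rewrite mulr0n sub0r P_bnd ?oppr0 // mulrDr ltrDr lt_neqAle he andbT.
by rewrite eq_sym mulf_neq0.
Qed.

(* T inverts P up to the factor f ^+ M and up to terms that are as low as
   wanted when M grows: the truncated geometric series of 1 / (f - U). *)
Let T M := xpow K (- w) * \sum_(i < M) cst f ^+ (M.-1 - i) * U ^+ i.

(** As x^{-w} P = f - U, this is the factorization of a difference of [M]-th powers. *)
Let PT M : P * T M = cst (f ^+ M) - U ^+ M.
Proof.
rewrite rmorphXn /= subrXX /T {2}/U opprB addrC subrK mulrCA mulrA.
by congr (_ * _); apply: eq_bigr => i _; rewrite subn1 subnAC.
Qed.

Let T_bnd M : xbnd r (r * - w) (T M).
Proof.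
have [d d0 hU] := U_gap.
have hU0 : xbnd r 0 U by apply: xbnd_weaken hU; rewrite oppr_le0 ltW.
rewrite -[r * - w]addr0; apply: xbndM; first exact: xbnd_xpow.
apply: xbnd_sum => i _.
have -> : 0 = 0 *+ (M.-1 - i) + 0 *+ i :> rat by rewrite !mul0rn addr0.
by apply: xbndM; apply: xbndX => //; apply: xbnd_cst.
Qed.

(** An error term: it would vanish if [T M] were exactly f^M / P. *)
Let D M := cst f * (Dy (T M) * Dx P - Dx (T M) * Dy P)
  - cst (M%:R * f^`()) * (T M * Dx P).

(** Multiplying by [P] lets [PT] and its derivatives eliminate [T M]; the contributions of f^M
    cancel and only terms with U^M, hence of low degree, survive. *)
Let PD M : P * D M =
  cst (M%:R * f^`()) * (U ^+ M * Dx P) +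
  (cst f * (Dx (U ^+ M) * Dy P) - cst f * (Dy (U ^+ M) * Dx P)).
Proof.
have hz : P * Dy (T M) = cst (f ^+ M)^`() - Dy (U ^+ M) - Dy P * T M.
  by rewrite -Dy_cst -raddfB -PT /= DyM; ring.
have hx : P * Dx (T M) = - Dx (U ^+ M) - Dx P * T M.
  have := congr1 (@Dx K) (PT M).
  by rewrite raddfB /= Dx_cst (DxM charK) sub0r => <-; ring.
have hf : cst f * cst (f ^+ M)^`() = cst (M%:R * f^`()) * cst (f ^+ M).
  rewrite -!rmorphM /= deriv_exp; congr cst.
  case: M {hz hx} => [|M]; first by rewrite mulr0n mulr0 mul0r mul0r.
  by rewrite -mulr_natl exprS; ring.
transitivity (cst f * (P * Dy (T M)) * Dx P - cst f * (P * Dx (T M)) * Dy P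
  - cst (M%:R * f^`()) * (P * T M) * Dx P); first by rewrite /D; ring.
rewrite hz hx PT.
transitivity ((cst f * cst (f ^+ M)^`()) * Dx P
  - cst f * Dy (U ^+ M) * Dx P + cst f * Dx (U ^+ M) * Dy P
  - cst (M%:R * f^`()) * (cst (f ^+ M) - U ^+ M) * Dx P); first by ring.
by rewrite hf; ring.
Qed.

Lemma leading_residue_equation : exists (M : nat) (A : {poly K}),
  M%:R * f^`() * A - f * A^`() = f ^+ M * f^`() * xc (-1) J.
Proof.
have [d d0 hU] := U_gap; have [g hG] := xbnd_exists r G.
(* [M] is chosen so that the gain d M outweighs the degree bound of [G]; then G D has no x^{-1}
   term. *)
have [n hn] : exists n : nat, g < d *+ n.+1.
  exists (Num.truncn (Num.max 0 (g / d))).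
  rewrite -mulr_natr mulrC -ltr_pdivrMr //.
  apply: (@le_lt_trans _ _ (Num.max 0 (g / d))).
    by rewrite le_max lexx orbT.
  by apply: truncnS_gt.
set M := n.+1 in hn.
have hdM : 0 < d *+ M by rewrite pmulrn_lgt0.
have hV : xbnd r (- (d *+ M)) (U ^+ M) by rewrite -mulNrn; apply: xbndX.
have hPx : xbnd r (r * w - r) (Dx P) by apply: xbnd_Dx.
have hPz : xbnd r (r * w) (Dy P) by apply: xbnd_Dy.
have hPD : xbnd r (r * w - r - d *+ M) (P * D M).
  rewrite PD; apply: xbndD; last apply: xbndB.
  - by apply: xbnd_cstM; apply: xbnd_weaken (xbndM hV hPx); lra.
  - by apply: xbnd_cstM; apply: xbnd_weaken (xbndM (xbnd_Dx hV) hPz); lra.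
  - by apply: xbnd_cstM; apply: xbnd_weaken (xbndM (xbnd_Dy hV) hPx); lra.
have hD0 : xbnd r (- r) (D M).
  apply: xbndB; apply: xbnd_cstM; last first.
    by apply: xbnd_weaken (xbndM (@T_bnd M) hPx); lra.
  apply: xbndB.
    by apply: xbnd_weaken (xbndM (xbnd_Dy (@T_bnd M)) hPx); lra.
  by apply: xbnd_weaken (xbndM (xbnd_Dx (@T_bnd M)) hPz); lra.
have hD : xbnd r (- r - d *+ M) (D M).
  move=> e he; apply: (mulfI (expf_neq0 M P_top)); rewrite mulr0 -xc_cstM.
  (* The bound on P D passes to D because f^M = T P + U^M: the first product is low by [hPD], the
     second by the smallness of U^M and the crude bound [hD0]. *)
  have -> : cst (f ^+ M) * D M = T M * (P * D M) + U ^+ M * D M.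
    by rewrite mulrA [T M * P]mulrC PT; ring.
  apply: (xbndD _ _ he).
    by apply: xbnd_weaken (xbndM (@T_bnd M) hPD); lra.
  by apply: xbnd_weaken (xbndM hV hD0); lra.
set A := xc (-1) (G * T M * Dx P).
exists M, A.
(* The second derivatives of [P] cancel, the derivatives of [T M] are collected in [D M], and those
   of [G] give [J] through [JE]. *)
have E : cst f * (Dy (G * T M * Dx P) - Dx (G * T M * Dy P)) =
    cst (M%:R * f^`()) * (G * T M * Dx P) + G * D M
    - cst f * (J * (T M * Dy P)).
  have -> : J * (T M * Dy P) = (Dx G * Dy P - Dy G * Dx P) * T M.
    by rewrite -JE; ring.
  by rewrite /D !DyM !(DxM charK) DxDy; ring.
have := congr1 (xc (-1)) E.
rewrite raddfB raddfD /= !xc_cstM.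
rewrite raddfB /= xc_Dy xc_Dx addNr -/A.
rewrite [xc (-1) (G * D M)](xbndM hG hD); last by rewrite mulrN1; lra.
(* An x-derivative has no x^{-1} term. *)
have -> : ratr 0 = 0 :> K by rewrite /ratr mul0r.
rewrite scale0r subr0 addr0.
have h1 : xc (-1) (J * (T M * Dy P)) = xc (-1) J * xc 0 (T M * Dy P).
  rewrite -{1}[-1]addr0; apply: (@xcM_top _ r) => //.
    by rewrite mulrN1.
  by apply: xbnd_weaken (xbndM (@T_bnd M) hPz); lra.
have h2 : xc 0 (T M * Dy P) = xc (- w) (T M) * f^`().
  by rewrite -xc_Dy -{1}[0](addNr w); apply: (@xcM_top _ r).
(* Top coefficients in [PT]: U^M has negative degree and does not contribute at x^0. *)
have h3 : f * xc (- w) (T M) = f ^+ M.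
  rewrite -(@xcM_top _ r) // subrr PT raddfB /= xc_cst mulr1n.
  by rewrite hV ?subr0 // mulr0 oppr_lt0.
rewrite h1 h2 => H.
transitivity (f * xc (- w) (T M) * f^`() * xc (-1) J); last by rewrite h3.
by rewrite H; ring.
Qed.

End LeadingResidue.

(** * Orders of vanishing and roots *)

(** After cancelling the smaller power, a remaining factor X - a would make the other side vanish at
    [a]. *)
Lemma exp_XsubC_eq (F : fieldType) (a : F) (b g : {poly F}) (m n : nat) :
  b * ('X - a%:P) ^+ m = g * ('X - a%:P) ^+ n ->
  b.[a] != 0 -> g.[a] != 0 -> m = n.
Proof.
wlog mn : m n b g / (m <= n)%N.
  move=> H E hb hg; case: (leqP m n) => mn; first exact: H E hb hg.
  by rewrite (H n m g b (ltnW mn) (esym E) hg hb).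
rewrite -(subnK mn) exprD mulrA => E hb hg.
have nz : ('X - a%:P) ^+ m != 0 by rewrite expf_neq0 ?polyXsubC_eq0.
move/(mulIf nz): E; case: (n - m)%N => [|k] E; first by [].
by move: hb; rewrite E exprS !hornerM hornerXsubC subrr mul0r mulr0 eqxx.
Qed.

(* If f vanishes to order m at a and h does not vanish there, the right side
   has order M m + m - 1.  The left side has order m + ord A - 1, unless its
   leading coefficient M m - ord A is 0, and then its order is larger; so
   equality is impossible. *)
Lemma root_of_leading_residue_equation (F : fieldType) (M : nat)
    (f A h : {poly F}) (a : F) : [pchar F] =i pred0 -> f != 0 ->
  M%:R * f^`() * A - f * A^`() = f ^+ M * f^`() * h -> root f a -> root h a.
Proof.
move=> charF f0 E fa; apply: contraTT isT => ha.
have [m [f1 nf1 Ef]] := multiplicity_XsubC f a.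
have {nf1} f1a : f1.[a] != 0 by rewrite -rootE; exact: (implyP nf1).
case: m Ef => [|m] Ef.
  by move: fa; rewrite Ef expr0 mulr1 rootE (negPf f1a).
set z := 'X - a%:P in Ef.
have za : z.[a] = 0 by rewrite /z !hornerE subrr.
have z' : z^`() = 1 by rewrite derivXsubC.
(* From here on the order of [f] at [a] is [m.+1], so its derivative has order [m]. *)
have Ef' : f^`() = (m.+1%:R * f1 + z * f1^`()) * z ^+ m.
  rewrite Ef derivM deriv_exp z' mul1r /= exprS -mulr_natl; ring.
have [k [A1 nA1 EA]] := multiplicity_XsubC A a.
rewrite -/z in EA.
(* The extra factor [z] avoids the exponent k - 1, as [A] need not vanish at [a]. *)
have EA' : z * A^`() = (k%:R * A1 + z * A1^`()) * z ^+ k.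
  rewrite EA derivM deriv_exp z' mul1r -mulr_natl.
  by case: k {EA} => [|k] /=; rewrite ?exprS; ring.
set phi := m.+1%:R * f1 + z * f1^`() in Ef'.
set alpha := k%:R * A1 + z * A1^`() in EA'.
have phia : phi.[a] = m.+1%:R * f1.[a].
  by rewrite /phi hornerD !hornerM za mul0r addr0 -polyC_natr hornerC.
have alphaa : alpha.[a] = k%:R * A1.[a].
  by rewrite /alpha hornerD !hornerM za mul0r addr0 -polyC_natr hornerC.
have ma0 : (m.+1%:R : F) != 0 by apply: natr_neq0_pchar0.
have zm0 : z ^+ m != 0 by rewrite expf_neq0 // polyXsubC_eq0.
have ga : (f1 ^+ M * phi * h).[a] != 0.
  by rewrite !hornerM horner_exp phia !mulf_neq0 ?expf_neq0.
have E2 : (M%:R * phi * A1 - f1 * alpha) * z ^+ k =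
    (f1 ^+ M * phi * h) * z ^+ (m.+1 * M).
  apply: (mulIf zm0).
  transitivity (M%:R * f^`() * A - f * A^`()).
    rewrite Ef' {1}EA Ef exprS.
    transitivity (M%:R * (phi * z ^+ m) * (A1 * z ^+ k)
      - f1 * z ^+ m * (z * A^`())); last by ring.
    by rewrite EA'; ring.
  by rewrite E Ef' {1}Ef exprMn -exprM; ring.
have A0 : A != 0.
  apply: contraNneq ga => A0; move: E2; rewrite /alpha.
  move: EA; rewrite A0 => /esym/eqP.
  rewrite mulf_eq0 (expf_eq0 z) polyXsubC_eq0 andbF orbF => /eqP ->.
  rewrite deriv0 !mulr0 addr0 mulr0 subr0 mul0r => /esym/eqP.
  rewrite mulf_eq0 (expf_eq0 z) polyXsubC_eq0 andbF orbF => /eqP ->.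
  by rewrite horner0.
have A1a : A1.[a] != 0 by rewrite -rootE; exact: (implyP nA1).
have ba : (M%:R * phi * A1 - f1 * alpha).[a] =
    ((m.+1 * M)%:R - k%:R) * (f1.[a] * A1.[a]).
  rewrite hornerD hornerN !hornerM phia alphaa -polyC_natr hornerC natrM.
  ring.
(* If the orders agree, cancelling the power of [z] leaves a left side that vanishes at [a] by [ba]
   and a right side that does not. Otherwise both cofactors are nonzero at [a], which forces the
   orders to agree. *)
have [ke|kn] := eqVneq k (m.+1 * M)%N.
  move: E2; rewrite ke => /mulIf E2.
  move: ga; rewrite -E2 ?expf_neq0 ?polyXsubC_eq0 //.
  by rewrite ba -ke subrr mul0r eqxx.
case/eqP: (kn); apply: (exp_XsubC_eq E2).
- rewrite ba !mulf_neq0 // subr_eq0.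
  apply: contraNneq kn => H; apply/eqP; move: H.
  have inj (p q : nat) : (p <= q)%N -> (p%:R : F) = q%:R -> p = q.
    move=> pq /eqP; rewrite eq_sym -subr_eq0 -natrB //.
    by move/pcharf0P: charF => ->; rewrite subn_eq0 => qp; apply/eqP; rewrite eqn_leq pq.
  by case: (leqP k (m.+1 * M)) => [h1 /esym/(inj _ _ h1)|/ltnW h1 /(inj _ _ h1)].
- exact: ga.
Qed.

(** Split off the full power of X. If the cofactor were constant, [f] would be a monomial; so it has
    a root, which is nonzero since the cofactor does not vanish at 0. *)
Lemma closed_nonzero_root (F : closedFieldType) (f : {poly F}) (j k : nat) :
  f`_j != 0 -> f`_k != 0 -> j != k -> exists2 a, a != 0 & root f a.
Proof.
move=> fj fk jk; have [m [q nq Ef]] := multiplicity_XsubC f 0.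
have f0 : f != 0 by apply: contraNneq fj => ->; rewrite coef0.
move/implyP: nq => /(_ f0) nq; rewrite subr0 in Ef.
have [/size_poly1P[c c0 qc]|] := boolP (size q == 1).
  have kill n : f`_n != 0 -> n = m.
    rewrite Ef qc coefCM coefXn; by case: (n =P m) => // _; rewrite mulr0 eqxx.
  by move: jk; rewrite (kill _ fj) (kill _ fk) eqxx.
case/closed_rootP => a qa; exists a; last by rewrite Ef rootM qa.
by apply: contraNneq nq => <-.
Qed.

(** * Extension of scalars *)

Section ExtL.
Variables (K F : fieldType) (iota : {rmorphism K -> F}).
Implicit Types P : {poly xpoly K}.

Lemma coefxy_extL P e : coefxy (extL iota P) e = iota (coefxy P e).
Proof.
rewrite /coefxy coef_map_id0; last by rewrite msupp0 big_seq_fset0.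
case: e => i j /=; rewrite xcoef_sum.
rewrite -[RHS](@sum_msupp _ _ P`_j (fun c _ => iota c)) ?rmorph0 //.
by apply: eq_bigr => i' _; rewrite mcoeffU.
Qed.

End ExtL.

(** * Leading forms in sheared coordinates *)

Section LeadingForm.
Variables (K : fieldType) (rho sigma : int).
Implicit Types (P A : {poly xpoly K}) (v w : rat).
Local Notation r := (rho%:~R : rat).
Local Notation s := (sigma%:~R / rho%:~R : rat).

Lemma big_max_botP (I : eqType) (l : seq I) (W : I -> rat) v :
  \big[max_bot/None]_(e <- l) Some (W e) = Some v <->
  (forall e, e \in l -> W e <= v) /\ (exists2 e, e \in l & W e = v).
Proof.
elim: l v => [|a l IH] v.
  by rewrite big_nil; split=> // -[_ []].
rewrite big_cons; case E: (\big[_/_]_(_ <- l) _) => [u|] /=.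
  have [hu [e0 he0 We0]] := (IH u).1 E; split.
    case=> <-; split=> [e|].
      by rewrite inE le_max => /predU1P[->|/hu ->]; rewrite ?lexx ?orbT.
    case: (leP (W a) u) => h; last by exists a; rewrite ?mem_head.
    by exists e0; rewrite // inE he0 orbT.
  case=> hv [e he We]; congr Some; apply/le_anti/andP; split.
    by rewrite ge_max hv ?mem_head //= -We0 hv // inE he0 orbT.
  rewrite le_max -We; move: he; rewrite inE => /predU1P[->|/hu ->].
    by rewrite lexx.
  by rewrite orbT.
(* [max_bot] with a [Some] argument is never [None], so the value [None] occurs only for the empty
   list. *)
have l0 : l = [::].
  case: l {IH} E => // b l; rewrite big_cons.
  by case: (\big[_/_]_(_ <- l) _).
rewrite l0; split=> [[<-]|[_ [e]]].
  by split=> [e|]; [|exists a]; rewrite ?inE // => /eqP ->.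
by rewrite inE => /eqP -> ->.
Qed.

Lemma vdegP P v : vdeg rho sigma P = Some v <->
  (forall e, coefxy P e != 0 -> weight rho sigma e <= v) /\
  (exists2 e, coefxy P e != 0 & weight rho sigma e = v).
Proof.
rewrite /vdeg big_max_botP; split=> -[h [e he We]]; split.
- by move=> e'; rewrite -mem_supp => /h.
- by exists e; rewrite // -mem_supp.
- by move=> e'; rewrite mem_supp => /h.
- by exists e; rewrite // mem_supp.
Qed.

Lemma vdeg_monoxy (c : K) e : c != 0 ->
  vdeg rho sigma (monoxy c e) = Some (weight rho sigma e).
Proof.
move=> c0; apply/vdegP; split=> [e'|]; rewrite ?coefxy_monoxy.
  by case: (e =P e') => [->|]; rewrite ?mulr0n ?eqxx.
by exists e; rewrite // coefxy_monoxy eqxx.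
Qed.

Lemma coefxy_lead P e : coefxy (lead rho sigma P) e =
  if Some (weight rho sigma e) == vdeg rho sigma P then coefxy P e else 0.
Proof.
rewrite /lead coefxy_sum big_mkcond /=.
rewrite -[RHS](@sum_supp _ P (fun e => if Some (weight rho sigma e) ==
  vdeg rho sigma P then coefxy P e else 0)) => [|->]; last by rewrite if_same.
apply: eq_bigr => e' _; rewrite coefxy_monoxy.
by case: ifP; rewrite ?mul0rn.
Qed.

Hypothesis rho_neq0 : rho != 0.

Let r0 : r != 0. Proof. by rewrite intr_eq0. Qed.

(** The shear sends x^i y^j to x^{i + s j} y^j, so the weight becomes [r] times the degree in x. *)
Lemma weightE i j : weight rho sigma (i, j) = r * (i + s * j%:R).
Proof. by rewrite /weight /= mulrDr mulrA mulrCA divff // mulr1. Qed.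

Lemma xbnd_shear P w : vdeg rho sigma P = Some (r * w) ->
  xbnd r (r * w) (shear s P).
Proof.
case/vdegP => h _ e he; apply/polyP => j; rewrite coef_xc coefxy_shear coef0.
apply/eqP/negPn/negP => /h; rewrite weightE subrK.
by rewrite leNgt he.
Qed.

Lemma xc_shear_neq0 P w : vdeg rho sigma P = Some (r * w) ->
  xc w (shear s P) != 0.
Proof.
case/vdegP => _ [[i j] nz]; rewrite weightE => /(mulfI r0) Ew.
apply: contraNneq nz => /(congr1 (fun p : {poly K} => p`_j)).
by rewrite coef_xc coefxy_shear coef0 -Ew addrK => ->.
Qed.

(** The terms of top weight are exactly those that the shear sends to x-degree [w]; the opposite
    shear brings them back. *)
Lemma leadE P w : vdeg rho sigma P = Some (r * w) ->
  lead rho sigma P = shear (- s) (cst (xc w (shear s P)) * xpow K w).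
Proof.
move=> hv; apply: coefxyP => i j; rewrite coefxy_lead hv weightE.
rewrite (coefxy_shear (- s)) -[RHS]coef_xc xc_cstM xc_xpow mulNr opprK.
rewrite (inj_eq Some_inj) (inj_eq (mulfI r0)).
case: eqP => [<-|_]; last by rewrite mulr0 coef0.
by rewrite mulr1 coef_xc coefxy_shear addrK.
Qed.

(** Two terms of the leading form share the value i + s j; being distinct, they differ in the
    exponent of y. *)
Lemma inDir_coef P : inDir rho sigma P -> exists w j k,
  [/\ vdeg rho sigma P = Some (r * w), j != k,
      (xc w (shear s P))`_j != 0 & (xc w (shear s P))`_k != 0].
Proof.
case/andP=> _; have := supp_uniq (lead rho sigma P).
case E: (supp _) => [|[i j] [|[i' j'] l]] //= /andP[hn _] _.
have: (i, j) \in supp (lead rho sigma P) by rewrite E mem_head.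
have: (i', j') \in supp (lead rho sigma P).
  by rewrite E inE mem_head orbT.
rewrite !mem_supp !coefxy_lead.
case Ev: (vdeg rho sigma P) => [v|]; last by rewrite eqxx.
rewrite !(inj_eq Some_inj).
case: (weight rho sigma (i', j') =P v) => [w2 n2|_]; last by rewrite eqxx.
case: (weight rho sigma (i, j) =P v) => [w1 n1|_]; last by rewrite eqxx.
exists (i + s * j%:R), j, j'.
have E12 : i' + s * j'%:R = i + s * j%:R.
  by apply: (mulfI r0); rewrite -!weightE w1 w2.
rewrite -weightE w1 !coef_xc !coefxy_shear addrK -E12 addrK.
split=> //; apply: contraNneq hn => jj.
rewrite jj in E12; move/addIr: E12 => ->.
by rewrite jj mem_head.
Qed.

End LeadingForm.

(** * Products, linear factors and evaluation under the shear *)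

Section ShearAlgebra.
Variable K : fieldType.
Implicit Types (A B : {poly xpoly K}) (s : rat) (c : K).

Lemma shearM s A B : shear s (A * B) = shear s A * shear s B.
Proof. by rewrite shear.unlock rmorphM. Qed.

(** Applied at -s, this turns a linear factor z - c into y - c x^s up to a power of x. *)
Lemma shear_XsubC s c : shear s ('X - (xcst c)%:P) =
  xpow K s * ('X - (xmon c (- s))%:P).
Proof.
rewrite shear.unlock comp_polyB comp_polyX comp_polyC mulrBr; congr (_ - _).
by rewrite /xpow -rmorphM /= xmonM mul1r subrr.
Qed.

Lemma horner_shear s c A : (shear s A).[xmon c (- s)] = A.[xcst c].
Proof.
rewrite shear.unlock horner_comp hornerM hornerX hornerC.
by rewrite xmonM mul1r subrr.
Qed.

Lemma horner_cst (p : {poly K}) c : (cst p).[xcst c] = xcst p.[c].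
Proof. exact: horner_map. Qed.

End ShearAlgebra.

Section ExtLShear.
Variables (K F : fieldType) (iota : {rmorphism K -> F}).
Implicit Types P : {poly xpoly K}.

Lemma xc_shear_extL e s P :
  xc e (shear s (extL iota P)) = map_poly iota (xc e (shear s P)).
Proof.
apply/polyP => j; rewrite coef_map !coef_xc !coefxy_shear.
exact: coefxy_extL.
Qed.

Lemma vdeg_extL rho sigma P v : vdeg rho sigma P = Some v ->
  vdeg rho sigma (extL iota P) = Some v.
Proof.
case/vdegP => h [e he We]; apply/vdegP; split=> [e'|].
  by rewrite coefxy_extL fmorph_eq0 => /h.
by exists e; rewrite // coefxy_extL fmorph_eq0.
Qed.

Lemma Lring_extL l P : P \in Lring l -> extL iota P \in Lring l.
Proof.
by move=> /LringP h; apply/LringP => i j; rewrite coefxy_extL fmorph_eq0 => /h.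
Qed.

End ExtLShear.

(** * From a root of the sheared coefficient to a factor of the leading form *)

Section Factor.
Variables (F : fieldType) (rho sigma : int).
Hypothesis rho_neq0 : rho != 0.
Local Notation r := (rho%:~R : rat).
Local Notation s := (sigma%:~R / rho%:~R : rat).

(** The double sign matches [shear_XsubC] and [horner_shear] taken at -s. *)
Lemma etaE (a : F) : eta rho sigma a = xmon a (- - s).
Proof. by rewrite opprK. Qed.

Lemma dvdL_lead (l N : nat) (P : {poly xpoly F}) (w : rat) (a : F) :
  P \in Lring l -> vdeg rho sigma P = Some (r * w) ->
  root (xc w (shear s P)) a -> (l %| N)%N -> (`|rho|%N %| N)%N ->
  dvdL N ('X - (eta rho sigma a)%:P) (lead rho sigma P).
Proof.
move=> hP hv /factor_theorem[q Eq] /dvdnP[n1 N1] /dvdnP[n2 N2].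
have Ns : N%:R * s \is a Num.int.
  have -> : N%:R * s = (n2%:R * (Num.sg rho)%:~R) * sigma%:~R.
    rewrite N2 natrM natr_absz normrEsg intrM.
    by field; rewrite intr_eq0.
  by rewrite !rpredM ?rpred_nat ?rpred_int.
have Nw : N%:R * w \is a Num.int.
  have /vdegP[_ [[i j] nz]] := hv.
  rewrite weightE // => /mulfI <-; last by rewrite intr_eq0.
  rewrite mulrDr mulrA rpredD //; last by rewrite rpredM ?rpred_nat.
  by rewrite N1 natrM -mulrA rpredM ?rpred_nat //; apply: (LringP _ _ hP) nz.
(* With f = q (z - a), this is q sheared back, times the power of x split off by [shear_XsubC]. Its
   exponents of x are w - s - s j, which lie in (1/N)Z by [Nw] and [Ns]. *)
exists (xpow F (- s) * shear (- s) (cst q * xpow F w)).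
  apply/LringP => i j.
  rewrite -coef_xc xc_xpowM coef_xc coefxy_shear -coef_xc xc_cstM xc_xpow.
  case: (_ =P w) => [Ew _|_]; last by rewrite mulr0 coef0 eqxx.
  have -> : N%:R * i = N%:R * w - N%:R * s - N%:R * s * j%:R.
    by rewrite -Ew; ring.
  by rewrite !rpredB // rpredM ?rpred_nat.
rewrite (leadE rho_neq0 hv) Eq rmorphM /= -mulrA [cst ('X - _) * _]mulrC mulrA.
rewrite shearM.
have -> : cst ('X - a%:P) = 'X - (xcst a)%:P.
  by rewrite /cst rmorphB /= map_polyX map_polyC.
by rewrite shear_XsubC etaE; ring.
Qed.

Lemma horner_lead (P : {poly xpoly F}) (w : rat) (a : F) :
  vdeg rho sigma P = Some (r * w) -> root (xc w (shear s P)) a ->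
  (lead rho sigma P).[eta rho sigma a] = 0.
Proof.
move=> hv /eqP ha; rewrite (leadE rho_neq0 hv) etaE horner_shear hornerM.
by rewrite horner_cst ha rmorph0 mul0r.
Qed.

End Factor.

(** Before the shear, substituting the two derivatives of [G] cancels [Q]. Under the shear both
    sides acquire the factor x^s, since the extra chain rule terms in D_x are multiples of D_y and
    cancel in the Jacobian. *)
Lemma shear_potential (K : fieldType) (charK : [pchar K] =i pred0) (s : rat)
    (P Q G J : {poly xpoly K}) :
  Dx G = J - Q * Dx P -> Dy G = - (Q * Dy P) ->
  shear s J * Dy (shear s P) =
    Dx (shear s G) * Dy (shear s P) - Dy (shear s G) * Dx (shear s P).
Proof.
move=> hx hy; rewrite !(Dx_shear charK).
set c := cst _.
transitivity (xpow K s * shear s (Dx G * Dy P - Dy G * Dx P)); last first.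
  have sB A B : shear s (A - B) = shear s A - shear s B.
    by rewrite shear.unlock comp_polyB.
  by rewrite sB !shearM !Dy_shear; ring.
rewrite Dy_shear mulrCA -shearM; congr (_ * shear s _).
by rewrite hx hy; ring.
Qed.

(* In the third part lambda lies in F^*, where F is any algebraically closed
   extension of K (F = K if K is algebraically closed).  It need not lie in K:
   for K = Q, l = 1, P = x (y^2 + 1), Q = x^{-1}, one gets
   J = x^{-1} (y^2 + 1), and (1, 0) satisfies the hypotheses, but y^2 + 1 has
   no root in Q. *)
Theorem theorem1p5 (K : fieldType) (charK : [pchar K] =i pred0)
    (l : nat) (hl : (0 < l)%N) (P Q : {poly xpoly K})
    (hP : P \in Lring l) (hQ : Q \in Lring l) :
  let J := Jtilde P Q in
  let g := J - Q * Dx P in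
  [/\ Dy g = - Dx (Q * Dy P),
      exists2 h : {poly xpoly K}, h \in Lring l & g = Dx h
    & forall rho sigma : int,
        inDir rho sigma P -> rho != 0 ->
        vdeg rho sigma J = vdeg rho sigma (monoxy (1 : K) (-1, 0%N)) ->
        forall (F : closedFieldType) (iota : {rmorphism K -> F}),
        exists2 lambda : F, lambda != 0 &
          (forall N : nat, (0 < N)%N -> (l %| N)%N -> (`|rho|%N %| N)%N ->
             dvdL N ('X - (eta rho sigma lambda)%:P)
                    (lead rho sigma (extL iota P))) /\
          (lead rho sigma (extL iota J)).[eta rho sigma lambda] = 0].
Proof.
move=> J g; split; first exact: Dy_form.
  exists (intx g); first exact/Lring_intx/Lring_form.
  by rewrite (Dx_intx charK) // => j; apply: coefxy_form_N1.
move=> rho sigma hdir rho0 hvJ F iota.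
have [w [j [k [hvP jk fj fk]]]] := inDir_coef rho0 hdir.
have r0 : (rho%:~R : rat) != 0 by rewrite intr_eq0.
(* The weight of x^{-1} is -rho, so after the shear the leading form of [J] sits at x^{-1}, where
   the residue equation sees it. *)
have {}hvJ : vdeg rho sigma J = Some (rho%:~R * (-1)).
  by rewrite hvJ vdeg_monoxy ?oner_eq0 // weightE // mulr0 addr0.
have [G [Gx Gy]] := exists_potential charK P Q.
set s := sigma%:~R / rho%:~R : rat.
have hJ := xbnd_shear rho0 hvJ; rewrite mulrN1 in hJ.
have [M [A E]] := leading_residue_equation charK r0 (xbnd_shear rho0 hvP)
  (xc_shear_neq0 rho0 hvP) hJ (shear_potential charK s Gx Gy).
have charF : [pchar F] =i pred0 by move=> p; rewrite (fmorph_pchar iota) charK.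
have [a a0 fa] : exists2 a, a != 0 & root (xc w (shear s (extL iota P))) a.
  by apply: (@closed_nonzero_root _ _ j k);
    rewrite ?xc_shear_extL ?coef_map ?fmorph_eq0.
have ha : root (xc (-1) (shear s (extL iota J))) a.
  apply: (root_of_leading_residue_equation charF _ _ fa (M := M)
    (A := map_poly iota A)).
    exact: (xc_shear_neq0 rho0 (vdeg_extL iota hvP)).
  (* The equation [E] was obtained over [K] and is carried to [F] by [iota]. *)
  rewrite !xc_shear_extL !deriv_map -(rmorph_nat (map_poly iota)).
  by rewrite -rmorphXn -!rmorphM -rmorphB E.
exists a => //; split=> [N _|].
  exact: dvdL_lead (Lring_extL iota hP) (vdeg_extL iota hvP) fa.
exact: horner_lead (vdeg_extL iota hvJ) ha.
Qed.
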